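(* There is an algorithm which, given as input two finite $C(2)$ monoid presentations, decides whether the monoids they present are isomorphic.
   Context: A monoid presentation $\langle \mathscr{A} \mid \mathscr{R} \rangle$ consists of an alphabet $\mathscr{A}$ and a set $\mathscr{R} \subseteq \mathscr{A}^* \times \mathscr{A}^*$ of relations (finite if both are finite); the monoid presented is $\mathscr{A}^*$ modulo the smallest congruence containing $\mathscr{R}$. A relation word is a word occurring as one side of a relation. A piece is a word which occurs as a factor of two distinct relation words, or in two different (possibly overlapping) positions within one relation word; the empty word is always a piece. The presentation is $C(2)$ if no relation word can be written as a product of strictly fewer than $2$ pieces. *)

(* Defs.v *)
From mathcomp Require Import all_boot.
Set Implicit Arguments. Unset Strict Implicit. Unset Printing Implicit Defensive.

(* "Algorithm" is rendered as a mu-recursive code (Church-Turing).    *)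

Inductive code : Type :=
| CZero : code
| CSucc : code
| CProj : nat -> code
| CComp : code -> seq code -> code
| CPrec : code -> code -> code
| CMu   : code -> code.

Inductive eval : code -> seq nat -> nat -> Prop :=
| eval_zero v : eval CZero v 0
| eval_succ x v : eval CSucc (x :: v) x.+1
| eval_proj i v : i < size v -> eval (CProj i) v (nth 0 v i)
| eval_comp f gs v ws y :
    evals gs v ws -> eval f ws y -> eval (CComp f gs) v y
| eval_prec0 f g v y : eval f v y -> eval (CPrec f g) (0 :: v) y
| eval_precS f g n v z y :
    eval (CPrec f g) (n :: v) z -> eval g (n :: z :: v) y ->
    eval (CPrec f g) (n.+1 :: v) y
| eval_mu f v n :
    eval f (n :: v) 0 ->
    (forall m, m < n -> exists k, eval f (m :: v) k.+1) ->
    eval (CMu f) v n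
with evals : seq code -> seq nat -> seq nat -> Prop :=
| evals_nil v : evals [::] v [::]
| evals_cons g gs v w ws :
    eval g v w -> evals gs v ws -> evals (g :: gs) v (w :: ws).

Record pres := Pres {
  alpha : nat;
  rels : seq (seq 'I_alpha * seq 'I_alpha)
}.

Definition word (P : pres) := seq 'I_(alpha P).

(* Encoding of a presentation as a natural number (injective, computable). *)
Definition encode (P : pres) : nat :=
  pickle (alpha P, [seq (map val lr.1, map val lr.2) | lr <- rels P]).

Inductive cong (P : pres) : word P -> word P -> Prop :=
| cong_step (l r u v : word P) :
    (l, r) \in rels P -> cong (u ++ l ++ v) (u ++ r ++ v)
| cong_refl (u : word P) : cong u u
| cong_sym (u v : word P) : cong u v -> cong v u
| cong_trans (u v w : word P) : cong u v -> cong v w -> cong u w.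

(* The monoids presented by P and Q are isomorphic: there is a monoid
   homomorphism A_P^*/~P -> A_Q^*/~Q (given on representatives) which
   is bijective (with inverse given on representatives). *)
Definition presented_iso (P Q : pres) : Prop :=
  exists (f : word P -> word Q) (g : word Q -> word P),
    (forall u v, @cong P u v -> @cong Q (f u) (f v)) /\
    (forall u v, @cong Q (f (u ++ v)) (f u ++ f v)) /\
    @cong Q (f [::]) [::] /\
    (forall u v, @cong Q u v -> @cong P (g u) (g v)) /\
    (forall u, @cong P (g (f u)) u) /\
    (forall w, @cong Q (f (g w)) w).

Definition relword (P : pres) (w : word P) : Prop :=
  exists l r, (l, r) \in rels P /\ (w = l \/ w = r).

Definition occurs_at (P : pres) (p w : word P) (i : nat) : Prop :=
  take (size p) (drop i w) = p.

Definition factor (P : pres) (p w : word P) : Prop :=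
  exists i, occurs_at p w i.

Definition piece (P : pres) (p : word P) : Prop :=
  p = [::]
  \/ (exists w1 w2, [/\ relword w1, relword w2, w1 <> w2,
                         factor p w1 & factor p w2])
  \/ (exists w i j, [/\ relword w, i <> j, occurs_at p w i & occurs_at p w j]).

Definition Csc (n : nat) (P : pres) : Prop :=
  forall w : word P, relword w ->
  forall ps : seq (word P), (forall p, p \in ps -> piece p) ->
    flatten ps = w -> n <= size ps.

(* Main.v *)
Require Import Defs.
From mathcomp Require Import all_boot.
Set Implicit Arguments. Unset Strict Implicit. Unset Printing Implicit Defensive.

(* In a C(2) presentation no relation word is empty or a proper factor of another
   one. Hence a letter which is itself a relation word occurs in no other relation
   word: it is redundant if its class (for the equivalence generated by the
   relations on whole words) contains a word of length at least 2, and otherwise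
   it is one of several names of an irreducible element. After eliminating
   redundant letters and duplicate names, the generators are exactly the
   irreducible elements, so an isomorphism is a bijection between them. The
   relation words of length at least 2 with a nontrivial class are the minimal
   words with a nontrivial congruence class, and their congruence classes are
   their classes as whole words. So an isomorphism maps generators to words of
   bounded length, and verifying one only requires comparing classes of whole
   words, without any word problem: a finite search decides isomorphism. *)

(** * Recursive functions on natural numbers *)

Lemma eval_comp1 f g v a y :
  eval g v a -> eval f [:: a] y -> eval (CComp f [:: g]) v y.
Proof.
by move=> hg hf; apply: eval_comp hf; apply: evals_cons hg (evals_nil _).
Qed.

Lemma eval_comp2 f g h v a b y :
  eval g v a -> eval h v b -> eval f [:: a; b] y ->
  eval (CComp f [:: g; h]) v y.
Proof.
move=> hg hh hf; apply: eval_comp hf; apply: evals_cons hg _.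
exact: evals_cons hh (evals_nil _).
Qed.

Lemma eval_proj_nth i v y : i < size v -> nth 0 v i = y -> eval (CProj i) v y.
Proof. by move=> hi <-; apply: eval_proj. Qed.

Lemma eval_prec (F : nat -> nat) f g n v :
  eval f v (F 0) ->
  (forall k, k < n -> eval g (k :: F k :: v) (F k.+1)) ->
  eval (CPrec f g) (n :: v) (F n).
Proof.
move=> h0; elim: n => [|n IHn] hS; first exact: eval_prec0.
apply: eval_precS (hS n (ltnSn n)).
by apply: IHn => k ltkn; apply: hS; apply: leqW.
Qed.

(** * Codes for arithmetic and for the numbering of lists and pairs *)

Definition code_one := CComp CSucc [:: CZero].
Definition code_add := CPrec (CProj 0) (CComp CSucc [:: CProj 1]).
Definition code_pred := CPrec CZero (CProj 0).
(** [CPrec] recurses on the first argument, so the subtrahend comes first. *)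
Definition code_rsub := CPrec (CProj 0) (CComp code_pred [:: CProj 1]).
Definition code_eq0 := CPrec code_one CZero.
Definition code_odd := CPrec CZero (CComp code_eq0 [:: CProj 1]).
Definition code_half :=
  CPrec CZero (CComp code_add [:: CProj 1; CComp code_odd [:: CProj 0]]).
Definition code_shift := CPrec (CProj 0) (CComp code_half [:: CProj 1]).
(** The list numbering behind [pickle], [2 ^ x * (2 * s + 1)], obtained by doubling [2 * s + 1] [x]
    times. *)
Definition code_cons :=
  CPrec (CComp CSucc [:: CComp code_add [:: CProj 0; CProj 0]])
        (CComp code_add [:: CProj 1; CProj 1]).
(** The 2-adic valuation: the least number of halvings that makes the input odd. *)
Definition code_head := CMu (CComp code_eq0 [:: CComp code_odd [:: code_shift]]).
Definition code_behead :=
  CComp code_half [:: CComp code_shift [:: code_head; CProj 0]].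
Definition code_pair :=
  CComp code_cons [:: CProj 0; CComp code_cons [:: CProj 1; CZero]].
Definition code_snd := CComp code_head [:: code_behead].
Definition code_eq :=
  CComp code_eq0
    [:: CComp code_add
          [:: code_rsub; CComp code_rsub [:: CProj 1; CProj 0]]].

Lemma eval_one v : eval code_one v 1.
Proof. by apply: eval_comp1 (eval_zero v) _; apply: eval_succ. Qed.

Lemma eval_add x y : eval code_add [:: x; y] (x + y).
Proof.
apply: (eval_prec (F := fun k => k + y)); first exact: eval_proj.
by move=> k _; apply: eval_comp1; [apply: eval_proj | apply: eval_succ].
Qed.

Lemma eval_pred x : eval code_pred [:: x] x.-1.
Proof. by apply: eval_prec => [|k _]; [apply: eval_zero | apply: eval_proj]. Qed.

Lemma eval_rsub x y : eval code_rsub [:: x; y] (y - x).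
Proof.
apply: (eval_prec (F := fun k => y - k)).
  by apply: eval_proj_nth; rewrite ?subn0.
move=> k _; apply: eval_comp1; first exact: eval_proj.
by rewrite subnS; apply: eval_pred.
Qed.

Lemma eval_eq0 x : eval code_eq0 [:: x] (x == 0).
Proof.
apply: (eval_prec (F := fun k => k == 0)); first exact: eval_one.
by move=> k _; apply: eval_zero.
Qed.

Lemma eval_odd x : eval code_odd [:: x] (odd x).
Proof.
apply: (eval_prec (F := fun k => odd k)); first exact: eval_zero.
move=> k _; apply: eval_comp1; first exact: eval_proj.
by move: (eval_eq0 (odd k)); rewrite /=; case: (odd k).
Qed.

Lemma eval_half x : eval code_half [:: x] x./2.
Proof.
apply: eval_prec => [|k _]; first exact: eval_zero.
apply: (@eval_comp2 _ _ _ _ k./2 (odd k)); first exact: eval_proj.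
  by apply: eval_comp1 (eval_odd k); apply: eval_proj.
by rewrite -uphalfE uphalf_half addnC; apply: eval_add.
Qed.

Lemma eval_shift k n : eval code_shift [:: k; n] (iter k half n).
Proof.
apply: (eval_prec (F := fun k => iter k half n)); first exact: eval_proj.
move=> {}k _; apply: eval_comp1; first exact: eval_proj.
exact: eval_half.
Qed.

Lemma eval_cons x s : eval code_cons [:: x; s] (2 ^ x * s.*2.+1).
Proof.
apply: (eval_prec (F := fun x => 2 ^ x * s.*2.+1)).
  rewrite mul1n; apply: eval_comp1 (eval_succ _ _).
  by rewrite -addnn; apply: eval_comp2 (eval_add _ _); apply: eval_proj.
move=> k _; rewrite expnS -mulnA mul2n; move: (2 ^ k * _) => m; rewrite -addnn.
by apply: eval_comp2 (eval_add _ _); apply: eval_proj.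
Qed.

Lemma iter_half_expn x m y :
  m <= x -> iter m half (2 ^ x * y) = 2 ^ (x - m) * y.
Proof.
elim: m => [|m IHm] ltmx; first by rewrite subn0.
rewrite iterS IHm ?(ltnW ltmx) // -(subnSK ltmx) expnS -mulnA mul2n.
exact: doubleK.
Qed.

Lemma eval_head x s : eval code_head [:: 2 ^ x * s.*2.+1] x.
Proof.
have ev m : m <= x -> eval (CComp code_eq0 [:: CComp code_odd [:: code_shift]])
    [:: m; 2 ^ x * s.*2.+1] (~~ odd (2 ^ (x - m) * s.*2.+1)).
  move=> lemx; rewrite -(@iter_half_expn x m) //.
  have := eval_eq0 (odd (iter m half (2 ^ x * s.*2.+1))).
  rewrite eqb0; apply: eval_comp1; apply: eval_comp1 (eval_odd _).
  exact: eval_shift.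
apply: eval_mu => [|m ltmx].
  by have := ev x (leqnn x); rewrite subnn mul1n /= odd_double.
exists 0; have := ev m (ltnW ltmx).
by rewrite -(subnSK ltmx) expnS -mulnA mul2n odd_double.
Qed.

Lemma eval_behead x s : eval code_behead [:: 2 ^ x * s.*2.+1] s.
Proof.
apply: (@eval_comp1 _ _ _ s.*2.+1).
  apply: eval_comp2 (eval_head x s) _ _; first exact: eval_proj.
  have := eval_shift x (2 ^ x * s.*2.+1).
  by rewrite iter_half_expn // subnn mul1n.
by have := eval_half s.*2.+1; rewrite -uphalfE uphalf_double.
Qed.

Lemma eval_eq x y : eval code_eq [:: x; y] (x == y).
Proof.
have -> : (x == y) = (y - x + (x - y) == 0).
  by rewrite addn_eq0 !subn_eq0 eqn_leq andbC.
apply: eval_comp1 (eval_eq0 _); apply: eval_comp2 (eval_add _ _).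
  exact: eval_rsub.
by apply: eval_comp2 (eval_rsub _ _); apply: eval_proj.
Qed.

(** * Computable functions between countable types *)

Definition computable (A B : countType) (f : A -> B) :=
  exists c, forall a, eval c [:: pickle a] (pickle (f a)).

Lemma pickle_pair (A B : countType) (a : A) (b : B) :
  pickle (a, b) = 2 ^ pickle a * (2 ^ pickle b * 0.*2.+1).*2.+1.
Proof. by []. Qed.

Lemma pickle_cons (A : countType) (a : A) s :
  pickle (a :: s) = 2 ^ pickle a * (pickle s).*2.+1.
Proof. by []. Qed.

Lemma pickle_bool (b : bool) : pickle b = b.
Proof. by case: b. Qed.

Lemma eval_pair (A B : countType) (a : A) (b : B) :
  eval code_pair [:: pickle a; pickle b] (pickle (a, b)).
Proof.
rewrite pickle_pair; apply: eval_comp2 (eval_cons _ _); first exact: eval_proj.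
by apply: eval_comp2 (eval_zero _) (eval_cons _ _); apply: eval_proj.
Qed.

Lemma eval_fst (A B : countType) (p : A * B) :
  eval code_head [:: pickle p] (pickle p.1).
Proof. by case: p => a b; rewrite pickle_pair; apply: eval_head. Qed.

Lemma eval_snd (A B : countType) (p : A * B) :
  eval code_snd [:: pickle p] (pickle p.2).
Proof.
case: p => a b; rewrite pickle_pair.
exact: eval_comp1 (eval_behead _ _) (eval_head _ _).
Qed.

(** * Closure properties of computable functions *)

Section Computable.

Variable E : countType.
Implicit Types A B C T : countType.

Lemma computable_ext A (f g : E -> A) :
  (forall e, f e = g e) -> computable f -> computable g.
Proof. by move=> fg [c hc]; exists c => e; rewrite -fg. Qed.

Lemma computable_id : computable (fun e : E => e).
Proof. by exists (CProj 0) => e; apply: eval_proj. Qed.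

Lemma computable_comp A B (f : A -> B) (g : E -> A) :
  computable f -> computable g -> computable (fun e => f (g e)).
Proof.
move=> [c hc] [d hd]; exists (CComp c [:: d]) => e.
exact: eval_comp1 (hd e) (hc _).
Qed.

Lemma computable_pair A B (f : E -> A) (g : E -> B) :
  computable f -> computable g -> computable (fun e => (f e, g e)).
Proof.
move=> [c hc] [d hd]; exists (CComp code_pair [:: c; d]) => e.
exact: eval_comp2 (hc e) (hd e) (eval_pair _ _).
Qed.

Lemma computable_fst A B (f : E -> A * B) :
  computable f -> computable (fun e => (f e).1).
Proof.
by apply: computable_comp; exists code_head => p; apply: eval_fst.
Qed.

Lemma computable_snd A B (f : E -> A * B) :
  computable f -> computable (fun e => (f e).2).
Proof.
by apply: computable_comp; exists code_snd => p; apply: eval_snd.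
Qed.

Lemma computable_nil A : computable (fun _ : E => [::] : seq A).
Proof. by exists CZero => e; apply: eval_zero. Qed.

Lemma computable_cons A (f : E -> A) (g : E -> seq A) :
  computable f -> computable g -> computable (fun e => f e :: g e).
Proof.
move=> [c hc] [d hd]; exists (CComp code_cons [:: c; d]) => e.
exact: eval_comp2 (hc e) (hd e) (eval_cons _ _).
Qed.

Lemma computable_zero : computable (fun _ : E => 0).
Proof. by exists CZero => e; apply: eval_zero. Qed.

Lemma computable_succ (f : E -> nat) :
  computable f -> computable (fun e => (f e).+1).
Proof. by apply: computable_comp; exists CSucc => n; apply: eval_succ. Qed.

Lemma computable_false : computable (fun _ : E => false).
Proof. by exists CZero => e; apply: eval_zero. Qed.

Lemma computable_true : computable (fun _ : E => true).
Proof. by exists code_one => e; apply: eval_one. Qed.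

Lemma computable_eq A (f g : E -> A) :
  computable f -> computable g -> computable (fun e => f e == g e).
Proof.
move=> [c hc] [d hd]; exists (CComp code_eq [:: c; d]) => e.
rewrite pickle_bool -(inj_eq (pcan_inj pickleK)).
exact: eval_comp2 (hc e) (hd e) (eval_eq _ _).
Qed.

Lemma computable_if A (b : E -> bool) (f g : E -> A) :
  computable b -> computable f -> computable g ->
  computable (fun e => if b e then f e else g e).
Proof.
move=> [cb hb] [c hc] [d hd].
(* The recursion runs on the truth value, coded 0 or 1; its step receives 0, the value of [g] and
   [e], hence [CProj 2]. *)
exists (CComp (CPrec d (CComp c [:: CProj 2])) [:: cb; CProj 0]) => e.
apply: eval_comp2 (hb e) _ _; first exact: eval_proj.
rewrite pickle_bool; case: (b e) => /=; last exact: eval_prec0.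
apply: eval_precS; first exact: eval_prec0 (hd e).
by apply: eval_comp1 (hc e); apply: eval_proj.
Qed.

(* The code for [f] only runs on nonempty lists: [code_head] diverges on 0. *)
Lemma computable_match A T (s : E -> seq T) (z : E -> A)
    (f : E -> T -> seq T -> A) :
  computable s -> computable z ->
  computable (fun p : E * (T * seq T) => f p.1 p.2.1 p.2.2) ->
  computable (fun e => if s e is x :: s' then f e x s' else z e).
Proof.
move=> [cs hs] [cz hz] [c hc].
pose arg := CComp code_pair
  [:: CProj 0; CComp code_pair [:: CComp code_head [:: cs];
                                   CComp code_behead [:: cs]]].
pose flag := CComp code_eq0 [:: CComp code_eq0 [:: cs]].
exists (CComp (CPrec cz (CComp (CComp c [:: arg]) [:: CProj 2]))
              [:: flag; CProj 0]) => e.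
have ev_flag : eval flag [:: pickle e] (pickle (s e) != 0).
  have := eval_eq0 (pickle (s e) == 0); rewrite eqb0; apply: eval_comp1.
  exact: eval_comp1 (hs e) (eval_eq0 _).
apply: eval_comp2 ev_flag _ _; first exact: eval_proj.
have := hs e; case: (s e) => [|x s'] hse; first exact: (eval_prec0 _ (hz e)).
rewrite (_ : _ != 0); last first.
  by rewrite pickle_cons muln_eq0 negb_or -lt0n expn_gt0.
apply: eval_precS; first exact: eval_prec0 (hz e).
apply: (@eval_comp1 _ _ _ (pickle e)); first exact: eval_proj.
apply: (@eval_comp1 _ _ _ (pickle (e, (x, s')))); last exact: (hc (e, (x, s'))).
apply: eval_comp2 (eval_pair _ _); first exact: eval_proj.
apply: eval_comp2 (eval_pair _ _); apply: eval_comp1 hse _.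
  exact: eval_head.
exact: eval_behead.
Qed.

Lemma computable_iter A (n : E -> nat) (f : E -> A -> A) (z : E -> A) :
  computable n -> computable z -> computable (fun p : E * A => f p.1 p.2) ->
  computable (fun e => iter (n e) (f e) (z e)).
Proof.
move=> [cn hn] [cz hz] [c hc].
pose step := CComp c [:: CComp code_pair [:: CProj 2; CProj 1]].
exists (CComp (CPrec cz step) [:: cn; CProj 0]) => e.
apply: eval_comp2 (hn e) _ _; first exact: eval_proj.
apply: (eval_prec (F := fun k => pickle (iter k (f e) (z e)))) (hz e) _.
move=> k _; apply: eval_comp1 (hc (e, iter k (f e) (z e))).
by apply: eval_comp2 (eval_pair _ _); apply: eval_proj.
Qed.

End Computable.

(** Provides fuel for folds: the code of a list is itself a computable bound on the number of
    steps. *)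
Lemma size_le_pickle (T : countType) (s : seq T) : size s <= pickle s.
Proof.
elim: s => //= x s IHs; rewrite pickle_cons -[X in X <= _]mul1n.
rewrite leq_mul ?expn_gt0 // ltnS (leq_trans IHs) //.
by rewrite -addnn leq_addr.
Qed.

(** The state pairs the pending input with the accumulator; it is stationary once the input is
    exhausted, so surplus iterations are harmless. *)
Definition foldl_step (T A : Type) (f : A -> T -> A) (p : seq T * A) :=
  if p.1 is x :: s then (s, f p.2 x) else p.

Lemma iter_foldl_step (T A : Type) (f : A -> T -> A) k s z :
  size s <= k -> iter k (foldl_step f) (s, z) = ([::], foldl f z s).
Proof.
elim: k s z => [|k IHk] [|x s] z //= lesk; last by rewrite -iterS iterSr IHk.
by rewrite IHk.
Qed.

Lemma computable_foldl (E A T : countType) (s : E -> seq T) (z : E -> A)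
    (f : E -> A -> T -> A) :
  computable s -> computable z ->
  computable (fun p : E * (A * T) => f p.1 p.2.1 p.2.2) ->
  computable (fun e => foldl (f e) (z e) (s e)).
Proof.
move=> hs hz hf.
pose g e := (iter (pickle (s e)) (foldl_step (f e)) (s e, z e)).2.
apply: (@computable_ext _ _ g) => [e|].
  by rewrite /g iter_foldl_step ?size_le_pickle.
apply: computable_snd; apply: computable_iter => //.
  exact: computable_pair.
apply: computable_match.
- exact: (computable_fst (computable_snd (computable_id _))).
- exact: (computable_snd (computable_id _)).
have hp := computable_id (E * (seq T * A) * (T * seq T))%type.
have hT := computable_snd hp; have hEA := computable_fst hp.
apply: computable_pair; first exact: computable_snd hT.
apply: (computable_comp hf
  (g := fun p : E * (seq T * A) * (T * seq T) => (p.1.1, (p.1.2.2, p.2.1)))).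
apply: computable_pair (computable_fst hEA) _.
exact: computable_pair (computable_snd (computable_snd hEA)) (computable_fst hT).
Qed.

Lemma computable_rev (E T : countType) (s : E -> seq T) :
  computable s -> computable (fun e => rev (s e)).
Proof.
move=> hs; pose g e := foldl (fun a x => x :: a) [::] (s e).
apply: (@computable_ext _ _ g) => [e|].
  by rewrite /g /rev; elim: (s e) [::] => //= x s' IHs a.
apply: computable_foldl hs (computable_nil _ _) _.
have hp := computable_snd (computable_id (E * (seq T * T))%type).
exact: computable_cons (computable_snd hp) (computable_fst hp).
Qed.

Lemma computable_foldr (E A T : countType) (s : E -> seq T) (z : E -> A)
    (f : E -> T -> A -> A) :
  computable s -> computable z ->
  computable (fun p : E * (T * A) => f p.1 p.2.1 p.2.2) ->
  computable (fun e => foldr (f e) (z e) (s e)).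
Proof.
move=> hs hz hf.
apply: (@computable_ext _ _ (fun e => foldl (fun a x => f e x a) (z e) (rev (s e)))).
  by move=> e; rewrite foldl_rev.
apply: computable_foldl (computable_rev hs) hz _.
apply: (computable_comp hf (g := fun p : E * (A * T) => (p.1, (p.2.2, p.2.1)))).
have hp := computable_id (E * (A * T))%type; have hAT := computable_snd hp.
apply: computable_pair (computable_fst hp) _.
exact: computable_pair (computable_snd hAT) (computable_fst hAT).
Qed.

Ltac prove_computable :=
  try assumption;
  lazymatch goal with
  | |- computable (fun e => e) => exact: computable_id
  | |- computable (fun _ => nil) => exact: computable_nil
  | |- computable (fun _ => 0) => exact: computable_zero
  | |- computable (fun _ => true) => exact: computable_true
  | |- computable (fun _ => false) => exact: computable_false
  | |- computable fst => exact: (computable_fst (computable_id _))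
  | |- computable snd => exact: (computable_snd (computable_id _))
  | |- computable (fun e => fst _) => apply: computable_fst; prove_computable
  | |- computable (fun e => snd _) => apply: computable_snd; prove_computable
  | |- computable (fun e => S _) => apply: computable_succ; prove_computable
  | |- computable (fun e => (_, _)) => apply: computable_pair; prove_computable
  | |- computable (fun e => cons _ _) => apply: computable_cons; prove_computable
  | |- computable (fun e => _ == _) => apply: computable_eq; prove_computable
  | |- computable (fun e => if _ then _ else _) =>
      apply: computable_if; prove_computable
  | |- computable (fun e => foldr _ _ _) =>
      apply: computable_foldr; prove_computable
  | |- _ => idtac
  end.

(** * Computability of list operations *)

Section ComputableSeq.

Variables E T U : countType.

Lemma computable_cat (s t : E -> seq T) :
  computable s -> computable t -> computable (fun e => s e ++ t e).
Proof.
move=> hs ht; apply: (@computable_ext _ _ (fun e => foldr cons (t e) (s e))).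
  by move=> e; elim: (s e) => //= x s' ->.
by prove_computable.
Qed.

Lemma computable_size (s : E -> seq T) :
  computable s -> computable (fun e => size (s e)).
Proof.
move=> hs.
apply: (@computable_ext _ _ (fun e => foldr (fun _ n => n.+1) 0 (s e))).
  by move=> e; elim: (s e) => //= x s' ->.
by prove_computable.
Qed.

Lemma computable_all (s : E -> seq T) (a : E -> T -> bool) :
  computable s -> computable (fun p : E * T => a p.1 p.2) ->
  computable (fun e => all (a e) (s e)).
Proof.
move=> hs ha.
pose g e := foldr (fun x b => if a e x then b else false) true (s e).
apply: (@computable_ext _ _ g) => [e|].
  by rewrite /g; elim: (s e) => //= x s' ->; case: (a e x).
rewrite /g; prove_computable.
apply: (computable_comp ha (g := fun p : E * (T * bool) => (p.1, p.2.1))).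
by prove_computable.
Qed.

Lemma computable_map (s : E -> seq T) (f : E -> T -> U) :
  computable s -> computable (fun p : E * T => f p.1 p.2) ->
  computable (fun e => map (f e) (s e)).
Proof.
move=> hs hf; pose g e := foldr (fun x t => f e x :: t) [::] (s e).
apply: (@computable_ext _ _ g) => [e|].
  by rewrite /g; elim: (s e) => //= x s' ->.
rewrite /g; prove_computable.
apply: (computable_comp hf (g := fun p : E * (T * seq U) => (p.1, p.2.1))).
by prove_computable.
Qed.

End ComputableSeq.

Section ComputableSeqOps.

Variables E T : countType.

Lemma computable_has (s : E -> seq T) (a : E -> T -> bool) :
  computable s -> computable (fun p : E * T => a p.1 p.2) ->
  computable (fun e => has (a e) (s e)).
Proof.
move=> hs ha.
pose g e := if all (fun x => if a e x then false else true) (s e)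
            then false else true.
apply: (@computable_ext _ _ g) => [e|].
  by rewrite /g; elim: (s e) => //= x s'; case: (a e x).
rewrite /g; prove_computable.
by apply: computable_all => //; prove_computable.
Qed.

Lemma computable_andb (a b : E -> bool) :
  computable a -> computable b -> computable (fun e => a e && b e).
Proof. exact: (fun ha hb => computable_if ha hb (computable_false _)). Qed.

Lemma computable_flatten (s : E -> seq (seq T)) :
  computable s -> computable (fun e => flatten (s e)).
Proof.
move=> hs; rewrite /flatten; prove_computable.
by apply: computable_cat; prove_computable.
Qed.

Lemma computable_iota (n : E -> nat) :
  computable n -> computable (fun e => iota 0 (n e)).
Proof.
(* Prepending the current size builds the list in descending order, hence the outer [rev]. *)
move=> hn; pose g e := rev (iter (n e) (fun s => size s :: s) [::]).
apply: (@computable_ext _ _ g) => [e|].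
  rewrite /g; suff -> : iter (n e) (fun s => size s :: s) [::] = rev (iota 0 (n e)).
    by rewrite revK.
  elim: (n e) => //= k ->.
  by rewrite size_rev size_iota -/(iota 0 k.+1) -[in RHS]addn1 iotaD rev_cat.
apply: computable_rev; apply: computable_iter => //; first exact: computable_nil.
by apply: computable_cons; first apply: computable_size; prove_computable.
Qed.

Lemma computable_nth (z : E -> T) (s : E -> seq T) (i : E -> nat) :
  computable z -> computable s -> computable i ->
  computable (fun e => nth (z e) (s e) (i e)).
Proof.
move=> hz hs hi.
pose g e := if iter (i e) behead (s e) is x :: _ then x else z e.
apply: (@computable_ext _ _ g) => [e|].
  by rewrite /g; elim: (i e) (s e) => [|k IHk] [|x s'] //; rewrite iterSr IHk ?nth_nil.
apply: computable_match => //; last by prove_computable.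
apply: computable_iter => //; apply: computable_match; prove_computable.
Qed.

End ComputableSeqOps.

(** * The decision procedure *)

(* Union-find: each pair [(x, y)] of the list redirects [x] to [y]. *)
Definition redirect (W : eqType) (s : seq (W * W)) (x : W) : W :=
  foldr (fun p y => if y == p.1 then p.2 else y) x s.

Definition redirections (W : eqType) (R : seq (W * W)) : seq (W * W) :=
  foldr (fun lr s => (redirect s lr.1, redirect s lr.2) :: s) [::] R.

Definition class_rep (W : eqType) (R : seq (W * W)) (x : W) : W :=
  redirect (redirections R) x.

Definition seqs_upto (T : Type) (C : seq T) (k : nat) : seq (seq T) :=
  iter k (fun S => [::] :: [seq x :: w | x <- C, w <- S]) [:: [::]].

Definition pres_data := (nat * seq (seq nat * seq nat))%type.

Definition subst (f : seq (seq nat)) (w : seq nat) : seq nat :=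
  flatten [seq nth [::] f a | a <- w].

(** Total length of all relation words; the successor covers a letter that is its own normal form
    when there are no relations. *)
Definition length_bound (R : seq (seq nat * seq nat)) : nat :=
  (size (flatten [seq lr.1 ++ lr.2 | lr <- R])).+1.

(** Tables of generator images. The length bound comes from the source [p], since the images to be
    found are as long as the normal forms of the letters of [p]. *)
Definition candidates (p q : pres_data) : seq (seq (seq nat)) :=
  seqs_upto (seqs_upto (iota 0 q.1) (length_bound p.2)) p.1.

(** Congruence is replaced throughout by the decidable equivalence on whole words. The second test
    says that [g] after [f] fixes the generators. *)
Definition check_hom (p q : pres_data) (f g : seq (seq nat)) : bool :=
  all (fun lr => class_rep q.2 (subst f lr.1) == class_rep q.2 (subst f lr.2))
      p.2
  && all (fun a => class_rep p.2 (subst g (nth [::] f a))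
                   == class_rep p.2 [:: a]) (iota 0 p.1).

Definition decide_iso (p q : pres_data) : bool :=
  has (fun f => has (fun g => check_hom p q f g && check_hom q p g f)
                    (candidates q p)) (candidates p q).

(** * Computability of the decision procedure *)

Lemma computable_class_rep (E W : countType) (R : E -> seq (W * W)) (x : E -> W) :
  computable R -> computable x -> computable (fun e => class_rep (R e) (x e)).
Proof.
by move=> hR hx; rewrite /class_rep /redirections /redirect; prove_computable.
Qed.

Lemma computable_seqs_upto (E T : countType) (C : E -> seq T) (k : E -> nat) :
  computable C -> computable k -> computable (fun e => seqs_upto (C e) (k e)).
Proof.
move=> hC hk; apply: computable_iter => //; first by prove_computable.
apply: computable_cons; first by prove_computable.
apply: computable_flatten; apply: computable_map.
  by apply: (computable_comp hC); prove_computable.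
by apply: computable_map; prove_computable.
Qed.

Lemma computable_subst (E : countType) (f : E -> seq (seq nat)) (w : E -> seq nat) :
  computable f -> computable w -> computable (fun e => subst (f e) (w e)).
Proof.
move=> hf hw; apply: computable_flatten; apply: computable_map => //.
apply: computable_nth; [by prove_computable| |by prove_computable].
by apply: (computable_comp hf); prove_computable.
Qed.

Lemma computable_candidates (E : countType) (p q : E -> pres_data) :
  computable p -> computable q -> computable (fun e => candidates (p e) (q e)).
Proof.
move=> hp hq; apply: computable_seqs_upto; last by prove_computable.
apply: computable_seqs_upto; first by apply: computable_iota; prove_computable.
apply: computable_succ; apply: computable_size; apply: computable_flatten.
by apply: computable_map; last apply: computable_cat; prove_computable.
Qed.

Lemma computable_check_hom (E : countType) (p q : E -> pres_data) f g :
  computable p -> computable q -> computable f -> computable g ->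
  computable (fun e => check_hom (p e) (q e) (f e) (g e)).
Proof.
move=> hp hq hf hg; apply: computable_andb; apply: computable_all.
- by prove_computable.
- have hq1 : computable (fun u : E * (seq nat * seq nat) => q u.1).
    by apply: (computable_comp hq); prove_computable.
  have hf1 : computable (fun u : E * (seq nat * seq nat) => f u.1).
    by apply: (computable_comp hf); prove_computable.
  by apply: computable_eq; apply: computable_class_rep;
     try apply: computable_subst; prove_computable.
- by apply: computable_iota; prove_computable.
have hp1 : computable (fun u : E * nat => p u.1).
  by apply: (computable_comp hp); prove_computable.
have hf1 : computable (fun u : E * nat => f u.1).
  by apply: (computable_comp hf); prove_computable.
have hg1 : computable (fun u : E * nat => g u.1).
  by apply: (computable_comp hg); prove_computable.
apply: computable_eq; apply: computable_class_rep; try by prove_computable.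
by apply: computable_subst => //; apply: computable_nth; prove_computable.
Qed.

Lemma computable_decide_iso :
  computable (fun pq : pres_data * pres_data => decide_iso pq.1 pq.2).
Proof.
apply: computable_has; first by apply: computable_candidates; prove_computable.
apply: computable_has; first by apply: computable_candidates; prove_computable.
by apply: computable_andb; apply: computable_check_hom; prove_computable.
Qed.

(** * The equivalence relation on words generated by the relations *)

Section ClassRep.

Variable W : eqType.
Implicit Types (R : seq (W * W)) (x y : W).

Lemma class_rep_cons lr R x :
  class_rep (lr :: R) x =
  if class_rep R x == class_rep R lr.1 then class_rep R lr.2 else class_rep R x.
Proof. by []. Qed.

(** A redirection caused by [(l, r)] leads from the representative of [l] through [l] and [r] to
    that of [r], so merging never leaves an equivalence [S] containing the relations. *)
Lemma class_rep_ind R (S : W -> W -> Prop) :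
  (forall x, S x x) -> (forall x y, S x y -> S y x) ->
  (forall x y z, S x y -> S y z -> S x z) ->
  (forall l r, (l, r) \in R -> S l r) -> forall x, S x (class_rep R x).
Proof.
move=> S1 Ssym Strans; elim: R => [//|[l r] R IHR] SR x.
have {}IHR y : S y (class_rep R y).
  by apply: IHR => l' r' lrR; apply: SR; rewrite inE lrR orbT.
rewrite class_rep_cons /=; case: eqP => // eq_xl.
apply: (Strans _ (class_rep R l)); first by rewrite -eq_xl.
apply: (Strans _ l); first exact: Ssym.
by apply: (Strans _ r) (IHR r); apply: SR; rewrite mem_head.
Qed.

Lemma class_rep_rel R l r : (l, r) \in R -> class_rep R l = class_rep R r.
Proof.
elim: R => [//|lr R IHR]; rewrite inE !class_rep_cons => /orP[/eqP <- /=|/IHR -> //].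
by rewrite eqxx; case: eqP.
Qed.

Lemma class_rep_idem R x : class_rep R (class_rep R x) = class_rep R x.
Proof.
(* The induction principle is applied to the kernel of [class_rep R] itself. *)
apply/esym; apply: (@class_rep_ind R (fun x y => class_rep R x = class_rep R y)).
- by [].
- by move=> ? ? ->.
- by move=> ? ? ? -> ->.
exact: class_rep_rel.
Qed.

End ClassRep.

(** Transfers representatives from words over ordinals to the lists of naturals on which the
    algorithm works. *)
Lemma class_rep_inj_map (W W' : eqType) (h : W -> W') (R : seq (W * W)) x :
  injective h ->
  class_rep [seq (h lr.1, h lr.2) | lr <- R] (h x) = h (class_rep R x).
Proof.
move=> h_inj; elim: R x => [//|lr R IHR] x.
by rewrite map_cons !class_rep_cons /= !IHR inj_eq //; case: eqP.
Qed.

Definition rep (P : pres) (u : word P) : word P := class_rep (rels P) u.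

Section Cong.

Variable P : pres.
Implicit Types l r u v w x y : word P.

Lemma cong_context x y u v : cong u v -> cong (x ++ u ++ y) (x ++ v ++ y).
Proof.
elim=> [l r u' v' lrP | u' | u' v' _ | u' v' w' _ IH1 _].
- rewrite -!catA (catA x) (catA x u' (r ++ _)); exact: cong_step.
- exact: cong_refl.
- exact: cong_sym.
- exact: cong_trans.
Qed.

Lemma cong_cat u u' v v' : cong u u' -> cong v v' -> cong (u ++ v) (u' ++ v').
Proof.
move=> uu' vv'; apply: (cong_trans (v := u' ++ v)).
  exact: (cong_context [::] v uu').
by have := cong_context u' [::] vv'; rewrite !cats0.
Qed.

Lemma cong_flatten (T : Type) (f g : T -> word P) (s : seq T) :
  (forall a, cong (f a) (g a)) -> cong (flatten (map f s)) (flatten (map g s)).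
Proof.
by move=> fg; elim: s => [|a s IHs] /=; [apply: cong_refl | apply: cong_cat].
Qed.

Lemma rel_cong l r : (l, r) \in rels P -> cong l r.
Proof. by move=> lrP; have := cong_step [::] [::] lrP; rewrite !cats0. Qed.

Lemma rep_cong u v : rep u = rep v -> cong u v.
Proof.
have cr w : cong w (rep w).
  apply: class_rep_ind; [exact: cong_refl | exact: cong_sym | exact: cong_trans |].
  exact: rel_cong.
by move=> ruv; apply: (cong_trans (cr u)); rewrite ruv; apply: cong_sym.
Qed.

(** The disjunction is itself an equivalence containing the relations. *)
Lemma rep_eq_or_relword u v :
  rep u = rep v -> u = v \/ relword u /\ relword v.
Proof.
pose S u v := u = v \/ relword u /\ relword v.
have Ssym x y : S x y -> S y x by move=> [->|[]]; [left | right].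
have Strans x y z : S x y -> S y z -> S x z.
  move=> [-> //|[rx ry]] [<-|[_ rz]]; by right.
have Sr w : S w (rep w).
  apply: class_rep_ind => // [?|l r lrP]; first by left.
  by right; split; exists l, r; split=> //; [left | right].
by move=> ruv; apply: (Strans _ (rep u)) (Sr u) _; rewrite ruv; apply: Ssym.
Qed.

End Cong.

(** * Normal forms of letters, reduction of words, and rigidity *)

Definition relwords (P : pres) : seq (word P) :=
  flatten [seq [:: lr.1; lr.2] | lr <- rels P].

Lemma relwordsP (P : pres) (w : word P) : relword w <-> w \in relwords P.
Proof.
split=> [[l [r [lrP wlr]]]|/flattenP[_ /mapP[[l r] lrP ->]]].
  apply/flattenP; exists [:: l; r]; first by apply/mapP; exists (l, r).
  by rewrite !inE; case: wlr => ->; rewrite eqxx ?orbT.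
rewrite !inE => wlr; exists l, r; split=> //.
by case/orP: wlr => /eqP ->; [left | right].
Qed.

(* If the class of the letter [a] contains a word of length at least 2, then [a]
   is a redundant generator and is replaced by such a word; otherwise [a] is
   irreducible and is replaced by a letter representing its class. *)
Definition letter_nf (P : pres) (a : 'I_(alpha P)) : word P :=
  head (rep [:: a])
       [seq w <- relwords P | (1 < size w) && (rep w == rep [:: a])].

Definition ext (P Q : pres) (f : 'I_(alpha P) -> word Q) (u : word P) : word Q :=
  flatten (map f u).

Lemma ext_cat (P Q : pres) (f : 'I_(alpha P) -> word Q) u v :
  ext f (u ++ v) = ext f u ++ ext f v.
Proof. by rewrite /ext map_cat flatten_cat. Qed.

Lemma ext_seq1 (P Q : pres) (f : 'I_(alpha P) -> word Q) a :
  ext f [:: a] = f a.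
Proof. exact: cats0. Qed.

Definition reduce (P : pres) : word P -> word P := ext (@letter_nf P).

Definition reduced (P : pres) (u : word P) : bool :=
  all (fun a => letter_nf a == [:: a]) u.

(** A rigid word admits no replacement of a proper factor by a distinct equivalent word when both
    have length at least 2; it can only be rewritten as a whole. *)
Definition rigid (P : pres) (u : word P) : Prop :=
  forall x w y w', u = x ++ w ++ y -> rep w = rep w' -> w <> w' ->
    1 < size w -> 1 < size w' -> x = [::] /\ y = [::].

(** * Presentations satisfying [C(2)] *)

Section C2.

Variable P : pres.
Hypothesis P_C2 : Csc 2 P.
Implicit Types a b : 'I_(alpha P).
Implicit Types l r u v w x y : word P.

(** The empty word is a product of zero pieces. *)
Lemma relword_neq0 u : relword u -> u <> [::].
Proof. 
move=> ru u0; have p0 (p : word P) : p \in [::] -> piece p by [].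
by have := P_C2 ru p0 (esym u0).
Qed.

(** Otherwise [w] is a factor of two distinct relation words, itself and the larger one, hence a
    single piece, against [C(2)]. *)
Lemma relword_factor_eq x w y :
  relword (x ++ w ++ y) -> relword w -> x = [::] /\ y = [::].
Proof.
move=> ru rw; have [eq_w|/eqP neq_w] := eqVneq w (x ++ w ++ y).
  have := congr1 size eq_w; rewrite !size_cat => sz.
  have [/size0nil -> /size0nil ->] : size x = 0 /\ size y = 0.
    move: sz; rewrite addnCA -[LHS]addn0 => /addnI/esym/eqP.
    by rewrite addn_eq0 => /andP[/eqP -> /eqP ->].
  by [].
suff piece_w : piece w.
  have pw p : p \in [:: w] -> piece p by rewrite inE => /eqP ->.
  by have := P_C2 rw pw (cats0 w).
right; left; exists w, (x ++ w ++ y); split=> //.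
  by exists 0; rewrite /occurs_at drop0 take_size.
by exists (size x); rewrite /occurs_at drop_size_cat // take_size_cat.
Qed.

Lemma rep_eq_nil u : rep u = @rep P [::] -> u = [::].
Proof. by case/rep_eq_or_relword=> // -[_ /relword_neq0]. Qed.

Lemma rep_letter_nf a : rep (letter_nf a) = rep [:: a].
Proof.
rewrite /letter_nf; case E: [seq _ <- _ | _] => [|w s] /=.
  exact: class_rep_idem.
have : w \in w :: s by rewrite mem_head.
by rewrite -E mem_filter => /andP[/andP[_ /eqP]].
Qed.

Lemma letter_nf_eq a b : rep [:: a] = rep [:: b] -> letter_nf a = letter_nf b.
Proof. by rewrite /letter_nf => ->. Qed.

Lemma letter_nf_neq0 a : letter_nf a <> [::].
Proof.
by case: (rep_eq_or_relword (rep_letter_nf a)) => [-> //|[/relword_neq0]].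
Qed.

Lemma letter_nf_long a w :
  1 < size w -> rep w = rep [:: a] -> 1 < size (letter_nf a).
Proof.
move=> w_gt1 rep_w; have [eq_w|[rw _]] := rep_eq_or_relword rep_w.
  by rewrite eq_w in w_gt1.
have : w \in [seq w <- relwords P | (1 < size w) && (rep w == rep [:: a])].
  by rewrite mem_filter w_gt1 rep_w eqxx; apply/relwordsP.
rewrite /letter_nf; case E: [seq _ <- _ | _] => [//|w' s] _ /=.
have : w' \in w' :: s by rewrite mem_head.
by rewrite -E mem_filter => /andP[/andP[]].
Qed.

(** A letter changed by [letter_nf] is a relation word, so it cannot be a proper factor of [w]. *)
Lemma reduced_long_relword w : relword w -> 1 < size w -> reduced w.
Proof.
move=> rw w_gt1; apply/allP=> a aw.
case: {aw}(path.splitPr aw) rw w_gt1 => p q rw w_gt1.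
case: (rep_eq_or_relword (rep_letter_nf a)) => [-> //|[_ ra]].
have [p0 q0] := relword_factor_eq (x := p) (w := [:: a]) (y := q) rw ra.
by rewrite p0 q0 in w_gt1.
Qed.

Lemma reduced_letter_nf a : reduced (letter_nf a).
Proof.
case: (ltnP 1 (size (letter_nf a))) => [nf_gt1|].
  case: (rep_eq_or_relword (rep_letter_nf a)) => [nf_a|[rnf _]].
    by rewrite nf_a in nf_gt1.
  exact: reduced_long_relword.
(* A one-letter normal form [b] is equivalent to [a], so [b] has the same normal form, namely
   itself. *)
have := @letter_nf_neq0 a; have := rep_letter_nf a.
case E: (letter_nf a) => [|b [|//]] // rep_b _ _.
by rewrite /reduced /= (letter_nf_eq rep_b) E eqxx.
Qed.

Lemma reduce_cat u v : reduce (u ++ v) = reduce u ++ reduce v.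
Proof. exact: ext_cat. Qed.

Lemma reduce_reduced u : reduced u -> reduce u = u.
Proof.
by elim: u => //= a u IHu /andP[/eqP nf_a /IHu]; rewrite /reduce /ext /= nf_a => ->.
Qed.

Lemma reduced_reduce u : reduced (reduce u).
Proof.
elim: u => // a u IHu; rewrite /reduced all_cat; apply/andP; split=> //.
exact: reduced_letter_nf.
Qed.

Lemma size_reduce u : size u <= size (reduce u).
Proof.
elim: u => // a u IHu; rewrite /reduce /ext /= size_cat -add1n leq_add //.
by have := @letter_nf_neq0 a; case: (letter_nf a).
Qed.

Lemma cong_reduce u : cong (reduce u) u.
Proof.
rewrite -[X in cong _ X]flatten_seq1; apply: cong_flatten => a.
exact: rep_cong (rep_letter_nf a).
Qed.

Lemma rep_reduce_relword l : relword l -> rep (reduce l) = rep l.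
Proof.
move=> rl; case: (ltnP 1 (size l)) => [l_gt1|].
  by rewrite reduce_reduced // reduced_long_relword.
have := relword_neq0 rl; case: l rl => [|a [|//]] // _ _ _.
by rewrite /reduce ext_seq1 rep_letter_nf.
Qed.

(** A short reduction means that the common class has no long word, so [l] and [r] are two names of
    one irreducible letter. *)
Lemma reduce_relword_eq l r :
  relword l -> relword r -> rep l = rep r -> size (reduce l) <= 1 ->
  reduce l = reduce r.
Proof.
move=> rl rr eq_lr; case: (ltnP 1 (size l)) => [l_gt1|l_le1].
  by rewrite reduce_reduced ?reduced_long_relword // leqNgt l_gt1.
have := relword_neq0 rl; case: l rl eq_lr l_le1 => [|a [|//]] // _ eq_lr _ _.
rewrite /reduce ext_seq1 => nf_le1.
case: (ltnP 1 (size r)) => [r_gt1|r_le1].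
  by have := letter_nf_long r_gt1 (esym eq_lr); rewrite ltnNge nf_le1.
have := relword_neq0 rr; case: r {rr} eq_lr r_le1 => [|b [|//]] // eq_lr _ _.
by rewrite ext_seq1; apply: letter_nf_eq.
Qed.

(** A factor of [u] equivalent to a different word is a relation word, hence it is all of the
    surrounding relation word. *)
Lemma factor_relword_rigid x u y :
  relword (x ++ u ++ y) -> rigid u.
Proof.
move=> rxuy p w q w' eq_u rep_w neq_w _ _.
case: (rep_eq_or_relword rep_w) => // -[rw _].
have : relword ((x ++ p) ++ w ++ (q ++ y)) by move: rxuy; rewrite eq_u -!catA.
case/relword_factor_eq=> // + +.
by case: x p {rxuy eq_u} => [|? ?] [|? ?] //; case: q => [|? ?].
Qed.

(* A rewriting step either becomes trivial after reduction, or replaces a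
   factor which is a relation word of length at least 2 by another one. *)
Lemma cong_rigid u v : cong u v ->
  (rigid (reduce u) ->
     rigid (reduce v) /\ rep (reduce u) = rep (reduce v)) /\
  (rigid (reduce v) ->
     rigid (reduce u) /\ rep (reduce v) = rep (reduce u)).
Proof.
(* Both directions are carried along so that the induction passes through symmetry. *)
elim=> [l r x y lrP | w | w w' _ [] | w1 w2 w3 _ [IH12 IH21] _ [IH23 IH32]].
- have rl : relword l by exists l, r; split=> //; left.
  have rr : relword r by exists l, r; split=> //; right.
  have eq_lr : rep l = rep r by apply: class_rep_rel.
  have step l' r' : relword l' -> relword r' -> rep l' = rep r' ->
      rigid (reduce (x ++ l' ++ y)) ->
      rigid (reduce (x ++ r' ++ y)) /\
      rep (reduce (x ++ l' ++ y)) = rep (reduce (x ++ r' ++ y)).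
    rewrite !reduce_cat => rl' rr' eq_lr' prime_l.
    have [<- //|neq_lr] := eqVneq (reduce l') (reduce r').
    have rl_gt1 : 1 < size (reduce l').
      rewrite ltnNge; apply: contra_neqN neq_lr; exact: reduce_relword_eq.
    have rr_gt1 : 1 < size (reduce r').
      rewrite ltnNge; apply: contra_neqN neq_lr => /reduce_relword_eq.
      by move=> /(_ l' rr' rl' (esym eq_lr')).
    have rep_red : rep (reduce l') = rep (reduce r').
      by rewrite !rep_reduce_relword.
    (* Rigidity leaves no room for a context, so the step is an equivalence of whole words, and its
       result is a relation word, hence rigid. *)
    have [x0 y0] := prime_l _ _ _ _ erefl rep_red (elimN eqP neq_lr) rl_gt1 rr_gt1.
    rewrite x0 y0 /= !cats0; split=> //.
    case: (rep_eq_or_relword rep_red) => [/eqP|[_ rred]].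
      by rewrite (negbTE neq_lr).
    by apply: (@factor_relword_rigid [::] _ [::]); rewrite cats0.
  by split; apply: step.
- by [].
- by [].
by split=> [/IH12[/IH23[? <-] ->]|/IH32[/IH21[? <-] ->]].
Qed.

(** The empty word is rigid and alone in its class, and reduction never shortens a word. *)
Lemma cong_nil u : cong u [::] -> u = [::].
Proof.
case/cong_rigid=> _ [|_ /esym /rep_eq_nil red_u].
  by move=> [|//] [|//] [|//].
by apply/size0nil/eqP; rewrite -leqn0; have := size_reduce u; rewrite red_u.
Qed.

(** A single letter is rigid, having no factor of length 2, so [reduce u] lies in its class as a
    whole word. That class has no long word, and its only reduced letter is [a]. *)
Lemma cong_reduced_letter a u :
  letter_nf a = [:: a] -> cong [:: a] u -> reduce u = [:: a].
Proof.
move=> nf_a /cong_rigid[+ _].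
have -> : reduce [:: a] = [:: a] by rewrite /reduce ext_seq1.
case=> [|_ rep_u].
  move=> x w y w' /(congr1 size); rewrite !size_cat /= => sz _ _ w_gt1.
  have := leq_trans w_gt1 (leq_trans (leq_addr (size y) _) (leq_addl (size x) _)).
  by rewrite -sz.
have : size (reduce u) <= 1.
  rewrite leqNgt; apply/negP=> /letter_nf_long /(_ (esym rep_u)).
  by rewrite nf_a.
have := reduced_reduce u; case: (reduce u) rep_u => [/rep_eq_nil //|b [|//]] rep_b.
rewrite /reduced /= andbT => /eqP nf_b _.
by rewrite -nf_b -nf_a; apply: letter_nf_eq.
Qed.

End C2.

(** * Isomorphisms between [C(2)] monoids *)

Record inverse_homs (P Q : pres) (F : word P -> word Q) (G : word Q -> word P) :=
  InverseHoms {
    hom_cong : forall u v, cong u v -> cong (F u) (F v);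
    hom_cat : forall u v, cong (F (u ++ v)) (F u ++ F v);
    hom_nil : cong (F [::]) [::];
    inv_cong : forall u v, cong u v -> cong (G u) (G v);
    homK : forall u, cong (G (F u)) u;
    invK : forall w, cong (F (G w)) w
  }.

(** The inverse of a homomorphism is one: [G u ++ G v] is congruent to its image under [G] after
    [F], and [F] maps it to a word congruent to [u ++ v]. *)
Lemma inverse_homs_sym (P Q : pres) (F : word P -> word Q) (G : word Q -> word P) :
  inverse_homs F G -> inverse_homs G F.
Proof.
move=> [Fc Fcat F0 Gc FK GK]; split=> // [u v|].
  apply: cong_trans (FK _); apply: Gc.
  apply: cong_trans (cong_sym (Fcat _ _)).
  by apply: cong_cat; apply/cong_sym/GK.
by apply: (cong_trans (Gc _ _ (cong_sym F0))); apply: FK.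
Qed.

Lemma hom_ext (P Q : pres) (F : word P -> word Q) (G : word Q -> word P) u :
  inverse_homs F G -> cong (F u) (ext (fun a => F [:: a]) u).
Proof.
move=> FG; elim: u => [|a u IHu]; first exact: hom_nil FG.
apply: cong_trans (hom_cat FG [:: a] u) _.
exact: cong_cat (cong_refl _) IHu.
Qed.

Definition letter_image (P Q : pres) (F : word P -> word Q) (a : 'I_(alpha P)) :
  word Q := reduce (F [:: a]).

Section LetterImage.

Variables (P Q : pres) (F : word P -> word Q) (G : word Q -> word P).
Hypotheses (P_C2 : Csc 2 P) (FG : inverse_homs F G).
Implicit Types u : word P.

Lemma cong_letter_image u : cong (F u) (ext (letter_image F) u).
Proof.
apply: cong_trans (hom_ext u FG) _; apply: cong_flatten => a.
by apply: cong_sym; apply: cong_reduce.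
Qed.

Lemma hom_cong_nil u : cong (F u) [::] -> u = [::].
Proof.
move=> Fu; apply: (cong_nil P_C2); apply: cong_trans (cong_sym (homK FG u)) _.
apply: cong_trans (inv_cong FG Fu) _.
exact: hom_nil (inverse_homs_sym FG).
Qed.

End LetterImage.

Section IrreducibleLetters.

Variables (P Q : pres) (F : word P -> word Q) (G : word Q -> word P).
Hypotheses (P_C2 : Csc 2 P) (Q_C2 : Csc 2 Q) (FG : inverse_homs F G).
Implicit Types (a : 'I_(alpha P)) (u v : word P).

Let GF := inverse_homs_sym FG.

Lemma size_hom_letters (v : word Q) : size v <= size (ext (fun b => G [:: b]) v).
Proof.
elim: v => // b v IHv; rewrite /ext /= size_cat -add1n leq_add // lt0n size_eq0.
apply/eqP=> Gb; suff : [:: b] = [::] by [].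
by apply: (hom_cong_nil Q_C2 GF); rewrite Gb; apply: cong_refl.
Qed.

(* The generators fixed by [letter_nf] are exactly the irreducible elements of
   the monoid, so an isomorphism permutes them. *)
Lemma letter_image_irreducible a : letter_nf a = [:: a] ->
  exists2 b, letter_image F a = [:: b] & letter_nf b = [:: b].
Proof.
move=> nf_a; set v := letter_image F a.
have cong_v : cong v (F [:: a]) by apply: cong_reduce.
have : cong [:: a] (ext (fun b => G [:: b]) v).
  apply: cong_trans (hom_ext v GF).
  apply: cong_trans (cong_sym (homK FG _)) _.
  exact: (inv_cong FG (cong_sym cong_v)).
move/(cong_reduced_letter P_C2 nf_a) => red_v.
(* [G] sends each letter of [v] to a nonempty word, and the resulting word reduces to one letter. *)
have v_le1 : size v <= 1.
  apply: leq_trans (size_hom_letters v) _.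
  by apply: leq_trans (size_reduce P_C2 _) _; rewrite red_v.
have : v <> [::].
  move=> v0; suff : [:: a] = [::] by [].
  by apply: (hom_cong_nil P_C2 FG); apply: cong_sym; rewrite -v0.
have : reduced v by apply: reduced_reduce.
by case: v v_le1 {cong_v red_v} => [|b [|//]] // _ /andP[/eqP nf_b _] _; exists b.
Qed.

Lemma reduced_ext_letter_image u : reduced u ->
  reduced (ext (letter_image F) u) /\ size (ext (letter_image F) u) = size u.
Proof.
elim: u => // a u IHu /andP[/eqP nf_a /IHu[red_u sz_u]].
have [b im_a nf_b] := letter_image_irreducible nf_a.
by rewrite /ext /= im_a /= nf_b eqxx sz_u.
Qed.

(** The equality is literal, not just up to congruence, because each irreducible element has a
    single reduced name. *)
Lemma letter_imageK u :
  reduced u -> ext (letter_image G) (ext (letter_image F) u) = u.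
Proof.
elim: u => // a u IHu /andP[/eqP nf_a /IHu IH].
have [b im_a nf_b] := letter_image_irreducible nf_a.
rewrite [ext (letter_image F) _]/ext /= im_a /= -/(ext (letter_image F) u).
rewrite /ext /= -/(ext (letter_image G) _) IH.
suff -> : letter_image G b = [:: a] by [].
apply: cong_reduced_letter => //; apply: cong_trans (cong_sym (homK FG _)) _.
apply: (inv_cong FG); rewrite -im_a; apply: cong_sym; exact: cong_reduce.
Qed.

End IrreducibleLetters.

(** Stronger than being a homomorphism with left inverse [g]: equality is asked in the whole-word
    equivalence, which needs no word problem. *)
Definition hom_spec (P Q : pres) (f : 'I_(alpha P) -> word Q)
    (g : 'I_(alpha Q) -> word P) : Prop :=
  (forall l r, (l, r) \in rels P -> rep (ext f l) = rep (ext f r)) /\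
  (forall a, rep (ext g (f a)) = rep [:: a]).

(** Passing to the normal form first gives redundant letters an image of controlled length, obtained
    by renaming irreducible letters. *)
Definition gen_image (P Q : pres) (F : word P -> word Q) (a : 'I_(alpha P)) :
  word Q := ext (letter_image F) (letter_nf a).

Lemma ext_gen_image (P Q : pres) (F : word P -> word Q) u :
  ext (gen_image F) u = ext (letter_image F) (reduce u).
Proof.
elim: u => // a u IHu.
by rewrite -[reduce _]/(letter_nf a ++ reduce u) ext_cat -IHu.
Qed.

Section GenImage.

Variables (P Q : pres) (F : word P -> word Q) (G : word Q -> word P).
Hypotheses (P_C2 : Csc 2 P) (Q_C2 : Csc 2 Q) (FG : inverse_homs F G).

Let GF := inverse_homs_sym FG.

(** A rewritable factor [w] of the image is pulled back by the inverse renaming to a factor of [u].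
    This factor is rigid and congruent to a different reduced word, so it is a relation word and
    must be all of [u]. *)
Lemma letter_image_rigid u :
  relword u -> reduced u -> rigid (ext (letter_image F) u).
Proof.
move=> ru red_u x w y w' im_u rep_w neq_w w_gt1 w'_gt1.
have [rw rw'] : relword w /\ relword w' by case: (rep_eq_or_relword rep_w).
have red_w : reduced w by apply: reduced_long_relword.
have red_w' : reduced w' by apply: reduced_long_relword.
have [red_im _] := reduced_ext_letter_image P_C2 Q_C2 FG red_u.
have := red_im; rewrite im_u /reduced !all_cat => /and3P[red_x _ red_y].
set gam := ext (letter_image G).
have eq_u : u = gam x ++ gam w ++ gam y.
  by rewrite -!ext_cat -im_u letter_imageK.
have prime_w : rigid (gam w).
  by apply: (@factor_relword_rigid _ P_C2 (gam x) _ (gam y)); rewrite -eq_u.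
have [red_gw _] := reduced_ext_letter_image Q_C2 P_C2 GF red_w.
have [red_gw' _] := reduced_ext_letter_image Q_C2 P_C2 GF red_w'.
have : cong (gam w) (gam w').
  apply: cong_trans (cong_sym (cong_letter_image GF w)) _.
  apply: cong_trans (cong_letter_image GF w').
  exact: (inv_cong FG (rep_cong rep_w)).
case/(cong_rigid P_C2)=> + _.
rewrite !reduce_reduced // => /(_ prime_w)[_ /rep_eq_or_relword[eq_gw|[rgw _]]].
  case: neq_w; rewrite -(letter_imageK Q_C2 P_C2 GF red_w).
  by rewrite -/gam eq_gw letter_imageK.
have [gx0 gy0] : gam x = [::] /\ gam y = [::].
  by apply: relword_factor_eq rgw => //; rewrite -eq_u.
have [_ szx] := reduced_ext_letter_image Q_C2 P_C2 GF red_x.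
have [_ szy] := reduced_ext_letter_image Q_C2 P_C2 GF red_y.
by split; apply: size0nil; rewrite -?szx -?szy -/gam ?gx0 ?gy0.
Qed.

Lemma gen_image_spec : hom_spec (gen_image F) (gen_image G).
Proof.
split=> [l r lrP|a]; last first.
  have red_a := reduced_letter_nf P_C2 a.
  have [red_im _] := reduced_ext_letter_image P_C2 Q_C2 FG red_a.
  rewrite ext_gen_image reduce_reduced // letter_imageK //.
  exact: rep_letter_nf.
have rl : relword l by exists l, r; split=> //; left.
have rr : relword r by exists l, r; split=> //; right.
have rep_lr : rep l = rep r by apply: class_rep_rel.
have rep_red : rep (reduce l) = rep (reduce r) by rewrite !rep_reduce_relword.
(* Unless the reduced sides coincide, [reduce l] is a relation word, so its image is rigid and
   congruence with the other image becomes whole-word equivalence. *)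
rewrite !ext_gen_image; case: (rep_eq_or_relword rep_red) => [-> //|[rrl _]].
have red_l := reduced_reduce P_C2 l; have red_r := reduced_reduce P_C2 r.
have [red_iml _] := reduced_ext_letter_image P_C2 Q_C2 FG red_l.
have [red_imr _] := reduced_ext_letter_image P_C2 Q_C2 FG red_r.
have : cong (ext (letter_image F) (reduce l)) (ext (letter_image F) (reduce r)).
  apply: cong_trans (cong_sym (cong_letter_image FG _)) _.
  apply: cong_trans (cong_letter_image FG _).
  exact: (hom_cong FG (rep_cong rep_red)).
case/(cong_rigid Q_C2)=> + _.
rewrite (reduce_reduced red_iml) (reduce_reduced red_imr) => -[|_ //].
exact: letter_image_rigid.
Qed.

Lemma size_gen_image a : size (gen_image F a) = size (letter_nf a).
Proof.
by have [] := reduced_ext_letter_image P_C2 Q_C2 FG (reduced_letter_nf P_C2 a).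
Qed.

End GenImage.

(** * From verified generator images to an isomorphism *)

Lemma hom_spec_ext_cong (P Q : pres) (f : 'I_(alpha P) -> word Q)
    (g : 'I_(alpha Q) -> word P) (u v : word P) :
  hom_spec f g -> cong u v -> cong (ext f u) (ext f v).
Proof.
move=> [f_rel _]; elim=> [l r x y /f_rel/rep_cong lr | w | w w' _ | w1 w2 w3 _ + _].
- by rewrite !ext_cat; apply: cong_context.
- exact: cong_refl.
- exact: cong_sym.
- exact: cong_trans.
Qed.

Lemma hom_spec_extK (P Q : pres) (f : 'I_(alpha P) -> word Q)
    (g : 'I_(alpha Q) -> word P) (u : word P) :
  hom_spec f g -> cong (ext g (ext f u)) u.
Proof.
move=> [_ fK]; elim: u => [|a u IHu]; first exact: cong_refl.
rewrite -[ext f _]/(f a ++ ext f u) ext_cat -cat1s.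
exact: cong_cat (rep_cong (fK a)) IHu.
Qed.

Lemma hom_spec_iso (P Q : pres) (f : 'I_(alpha P) -> word Q)
    (g : 'I_(alpha Q) -> word P) :
  hom_spec f g -> hom_spec g f -> presented_iso P Q.
Proof.
move=> fg gf; exists (ext f), (ext g).
split; first by move=> *; apply: hom_spec_ext_cong fg _.
split; first by move=> *; rewrite ext_cat; apply: cong_refl.
split; first exact: cong_refl.
split; first by move=> *; apply: hom_spec_ext_cong gf _.
by split=> *; apply: hom_spec_extK.
Qed.

(** * Correctness of the decision procedure *)

Definition pres_to_data (P : pres) : pres_data :=
  (alpha P, [seq (map val lr.1, map val lr.2) | lr <- rels P]).

Lemma class_rep_data (P : pres) (u : word P) :
  class_rep (pres_to_data P).2 (map val u) = map val (rep u).
Proof. exact: (class_rep_inj_map _ _ (inj_map val_inj)). Qed.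

Lemma mem_seqs_upto (T : eqType) (C : seq T) k s :
  (s \in seqs_upto C k) = (size s <= k) && all (mem C) s.
Proof.
elim: k s => [|k IHk] [|x s] //.
rewrite /seqs_upto iterS -/(seqs_upto C k) in_cons /= ltnS.
apply/allpairsP/and3P=> [[[y w] /= [yC wk [-> ->]]]|[sk xC sC]].
  by move: wk; rewrite IHk => /andP[].
by exists (x, s); split; rewrite //= IHk sk.
Qed.

Lemma size_letter_nf_le (P : pres) (a : 'I_(alpha P)) :
  size (letter_nf a) <= length_bound (pres_to_data P).2.
Proof.
case: (rep_eq_or_relword (rep_letter_nf a)) => [-> //|[[l [r [lrP nf_a]]] _]].
apply: leqW; have /splitPr[s1 s2] : (map val l, map val r) \in (pres_to_data P).2.
  by apply/mapP; exists (l, r).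
rewrite map_cat flatten_cat /= !size_cat !size_map.
apply: leq_trans (leq_addl _ _); apply: leq_trans (leq_addr _ _).
by case: nf_a => ->; [apply: leq_addr | apply: leq_addl].
Qed.

Definition represents (P Q : pres) (fl : seq (seq nat))
    (f : 'I_(alpha P) -> word Q) : Prop :=
  forall a : 'I_(alpha P), nth [::] fl a = map val (f a).

Lemma subst_represents (P Q : pres) fl (f : 'I_(alpha P) -> word Q) u :
  represents fl f -> subst fl (map val u) = map val (ext f u).
Proof.
move=> flf; rewrite /subst /ext map_flatten -!map_comp.
by congr flatten; apply: eq_map => a; apply: flf.
Qed.

Lemma check_homP (P Q : pres) fl gl (f : 'I_(alpha P) -> word Q)
    (g : 'I_(alpha Q) -> word P) :
  represents fl f -> represents gl g ->
  reflect (hom_spec f g) (check_hom (pres_to_data P) (pres_to_data Q) fl gl).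
Proof.
move=> flf glg.
have rep_eq (R : pres) (u v : word R) :
    (class_rep (pres_to_data R).2 (map val u) ==
     class_rep (pres_to_data R).2 (map val v)) = (rep u == rep v).
  by rewrite !class_rep_data (inj_eq (inj_map val_inj)).
apply: (iffP andP) => -[f_rel fK]; split.
- move=> l r lrP; apply/eqP; rewrite -rep_eq -!(subst_represents _ flf).
  apply: (allP f_rel (map val l, map val r)).
  by apply/mapP; exists (l, r).
- move=> a; apply/eqP; rewrite -rep_eq -(subst_represents _ glg) -flf.
  by apply: (allP fK (val a)); rewrite mem_iota ltn_ord.
- apply/allP=> _ /mapP[[l r] lrP ->] /=.
  by rewrite !(subst_represents _ flf) rep_eq (f_rel l r).
apply/allP=> k; rewrite mem_iota => /= ltk.
have := fK (Ordinal ltk) => /eqP; rewrite -rep_eq.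
by rewrite -(subst_represents _ glg) -flf.
Qed.

(** All letters of a candidate are below [alpha Q], so [insub] discards none; positions past the end
    of the table denote the empty word. *)
Lemma candidate_represents (P Q : pres) fl :
  fl \in candidates (pres_to_data P) (pres_to_data Q) ->
  represents fl (fun a : 'I_(alpha P) => pmap insub (nth [::] fl a) : word Q).
Proof.
rewrite mem_seqs_upto => /andP[_ /allP fl_words] a /=.
rewrite (pmap_filter (insubK _)); apply/esym/all_filterP.
case: (ltnP a (size fl)) => [ltafl|lefla]; last by rewrite nth_default.
have := fl_words _ (mem_nth [::] ltafl); rewrite inE mem_seqs_upto => /andP[_].
by apply: sub_all => k; rewrite /= mem_iota isSome_insub.
Qed.

Definition fun_to_seq (P Q : pres) (f : 'I_(alpha P) -> word Q) : seq (seq nat) :=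
  [seq map val (f a) | a <- enum 'I_(alpha P)].

Lemma represents_fun_to_seq (P Q : pres) (f : 'I_(alpha P) -> word Q) :
  represents (fun_to_seq f) f.
Proof.
by move=> a; rewrite (nth_map a) ?nth_ord_enum // size_enum_ord.
Qed.

Lemma fun_to_seq_candidate (P Q : pres) (f : 'I_(alpha P) -> word Q) :
  (forall a, size (f a) <= length_bound (pres_to_data P).2) ->
  fun_to_seq f \in candidates (pres_to_data P) (pres_to_data Q).
Proof.
move=> f_size; rewrite mem_seqs_upto size_map size_enum_ord leqnn andTb.
apply/allP=> _ /mapP[a _ ->]; rewrite inE mem_seqs_upto size_map f_size /=.
by apply/allP=> _ /mapP[b _ ->]; rewrite inE mem_iota /=.
Qed.

Lemma decide_isoP (P Q : pres) : Csc 2 P -> Csc 2 Q ->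
  reflect (presented_iso P Q) (decide_iso (pres_to_data P) (pres_to_data Q)).
Proof.
move=> P_C2 Q_C2; apply: (iffP hasP).
  move=> [fl /candidate_represents flf /hasP[gl /candidate_represents glg]].
  by case/andP=> /(check_homP flf glg) fg /(check_homP glg flf); apply: hom_spec_iso.
move=> [F [G [Fc [Fcat [F0 [Gc [FK GK]]]]]]].
have FG : inverse_homs F G by split.
have GF := inverse_homs_sym FG.
(* The search succeeds at the tables of [gen_image F] and [gen_image G], whose words have the
   lengths of letter normal forms in their sources. *)
exists (fun_to_seq (gen_image F)).
  apply: fun_to_seq_candidate => a.
  by rewrite (size_gen_image P_C2 Q_C2 FG) size_letter_nf_le.
apply/hasP; exists (fun_to_seq (gen_image G)).
  apply: fun_to_seq_candidate => a.
  by rewrite (size_gen_image Q_C2 P_C2 GF) size_letter_nf_le.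
have rF := represents_fun_to_seq (gen_image F).
have rG := represents_fun_to_seq (gen_image G).
apply/andP; split; [apply/(check_homP rF rG) | apply/(check_homP rG rF)].
  exact: gen_image_spec FG.
exact: gen_image_spec GF.
Qed.

Theorem theorem2 :
  exists c : code,
    forall P Q : pres, Csc 2 P -> Csc 2 Q ->
      (presented_iso P Q -> eval c [:: encode P; encode Q] 1) /\
      (~ presented_iso P Q -> eval c [:: encode P; encode Q] 0).
Proof.
have [c hc] := computable_decide_iso.
(* [encode P] is the [pickle] of [pres_to_data P], so [code_pair] merges the two inputs into the
   single one expected by [c]. *)
exists (CComp c [:: code_pair]) => P Q P_C2 Q_C2.
have := eval_comp (evals_cons (eval_pair (pres_to_data P) (pres_to_data Q))
                              (evals_nil _)) (hc (_, _)).
rewrite pickle_bool /=.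
by case: (decide_isoP P_C2 Q_C2) => iso ev.
Qed.
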